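(* Let $\Sigma^-_2=\Sigma_{--}$ be the binary reverse shift. For every $n\ge3$, $$|\mathcal A_n(\Sigma^-_2)|=a_n+2^{n-2}-2,$$ where $a_n=\sum_{t=1}^{n-1}\psi_2(t)\,2^{n-t-1}$ and $\psi_2(t)$ is the number of primitive binary words of length $t$.
   Context: $\mathcal W_2$ is the set of infinite binary words $s_1s_2\cdots$. The order $\prec$ for $\Sigma_{--}$: for $s\ne t$, with $j$ minimal such that $s_j\ne t_j$, $s\prec t$ iff ($j-1$ even and $s_j<t_j$) or ($j-1$ odd and $s_j>t_j$). $\Sigma^-_2(s_1s_2\cdots)=s_2s_3\cdots$ on $(\mathcal W_2,\prec)$. $\mathrm{Pat}(s,\Sigma^-_2,n)$ is the permutation of $[n]$ in the same relative order under $\prec$ as $s,\Sigma^-_2(s),\dots,(\Sigma^-_2)^{n-1}(s)$, defined when these are pairwise distinct; $\mathcal A_n(\Sigma^-_2)$ is the set of all defined such patterns. A finite word is primitive if it is not a concatenation of $m>1$ copies of a shorter word. *)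

(* Defs.v *)
From mathcomp Require Import all_boot all_fingroup.
From mathcomp Require Import boolp.

Set Implicit Arguments.
Unset Strict Implicit.
Unset Printing Implicit Defensive.

(* Letters are 0 = false and 1 = true; words are indexed from 0, so [s j] is
   the letter s_(j+1), and the parity of "j - 1" in the order below is the
   parity of the 0-based index of the first difference. *)
Definition word2 := nat -> bool.

Definition shift (s : word2) : word2 := fun i => s i.+1.

(* The strict order of Sigma_{--}. *)
Definition prec (s t : word2) : Prop :=
  exists j : nat, [/\ forall i, i < j -> s i = t i, s j <> t j
    & (~~ odd j /\ s j < t j) \/ (odd j /\ s j > t j)].

(* [is_pat lt f x p]: Pat(x, f, n) is defined and equal to p. *)
Definition is_pat (X : Type) (lt : X -> X -> Prop) (f : X -> X) (n : nat)
    (x : X) (p : 'S_n) : Prop :=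
  (forall i j : 'I_n, i <> j -> iter i f x <> iter j f x) /\
  (forall i j : 'I_n, p i < p j <-> lt (iter i f x) (iter j f x)).

Definition allowed_patterns (n : nat) : {set 'S_n} :=
  [set p : 'S_n | `[< exists s : word2, is_pat prec shift s p >]].

Definition primitive_word (w : seq bool) : Prop :=
  ~ exists (m : nat) (u : seq bool),
      [/\ m > 1, size u < size w & w = flatten (nseq m u)].

Definition psi2 (t : nat) : nat :=
  #|[set w : t.-tuple bool | `[< primitive_word w >]]|.

Definition a_ (n : nat) : nat :=
  \sum_(1 <= t < n) psi2 t * 2 ^ (n - t - 1).

(* Main.v *)
Require Import Defs.
From mathcomp Require Import all_boot all_fingroup.
From mathcomp Require Import boolp zify.

Set Implicit Arguments.
Unset Strict Implicit.
Unset Printing Implicit Defensive.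

(* Let N = n - 1.  A word s is a prefix w of length N followed by a tail t, and
   its pattern is governed by the comparisons of t with u t for the nonempty
   suffixes u of w, i.e. of t with the periodic word u^oo.  Hence the patterns
   with prefix w correspond to the nonempty gaps left by the points u^oo.  These
   points correspond to the primitive suffixes of w, and the only empty gaps are
   the one below (01)^oo when w ends in 01 and the one above (10)^oo when w ends
   in 10.  Summing over w gives a_n + 2^N - 2 * 2^(N-2) = a_n + 2^(n-2).

   A pattern that arises from two prefixes makes the shift decreasing on the
   whole orbit, so that the orbit spirals.  An inward spiral determines its
   prefix, while each of the two outward spirals arises from exactly 0^N and
   1^N.  Discarding the prefix 1^N, which has two patterns, thus makes the
   count exact. *)

(** * The alternating order *)

(** At a first difference [j] the smaller word carries 0 if [j] is even and 1 if [j] is odd, that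
    is, the letter [odd j]. This form treats both parities at once. *)
Lemma precP (s t : word2) :
  prec s t <->
  exists j, [/\ forall i, i < j -> s i = t i, s j = odd j & t j = ~~ odd j].
Proof.
split=> -[j [eq_st]].
  move=> _ st; exists j; split=> //.
    by case: st => -[]; case: (odd j); case: (s j); case: (t j).
  by case: st => -[]; case: (odd j); case: (s j); case: (t j).
move=> sj tj; exists j; split=> //; rewrite sj tj; case: (odd j) => //=.
  by right.
by left.
Qed.

Lemma prec_irr (s : word2) : ~ prec s s.
Proof. by case/precP=> j [_ ->]; case: (odd j). Qed.

Lemma prec_trans (s t u : word2) : prec s t -> prec t u -> prec s u.
Proof.
case/precP=> j [st sj tj] /precP[k [tu tk uk]]; apply/precP.
case: (ltngtP j k) => [ltjk|ltkj|eqjk].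
- exists j; split=> //; last by rewrite -tu.
  by move=> i ltij; rewrite st // tu // (ltn_trans ltij).
- exists k; split=> //; last by rewrite st.
  by move=> i ltik; rewrite st ?tu // (ltn_trans ltik).
- by move: tk; rewrite -eqjk tj; case: (odd j).
Qed.

Lemma prec_asym (s t : word2) : prec s t -> ~ prec t s.
Proof. by move=> st ts; apply: (@prec_irr s); apply: prec_trans ts. Qed.

Lemma prec_neq (s t : word2) : prec s t -> s <> t.
Proof. by move=> st eq_st; apply: (@prec_irr s); rewrite {2}eq_st. Qed.

Lemma word_neqP (s t : word2) : s <> t -> exists i, s i != t i.
Proof.
move=> neq; apply: contrapT => nex; apply: neq; apply: funext => i.
by apply/eqP/negPn/negP => ne; apply: nex; exists i.
Qed.

Lemma prec_total (s t : word2) : s <> t -> prec s t \/ prec t s.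
Proof.
move=> /word_neqP neq; case: (ex_minnP neq) => j nej minj.
have eq_st i : i < j -> s i = t i.
  by move=> ltij; apply/eqP/negPn/negP => /minj; rewrite leqNgt ltij.
case: (boolP (s j == odd j)) => [/eqP sj|sj].
  left; apply/precP; exists j; split=> //.
  by move: nej; rewrite sj; case: (odd j); case: (t j).
right; apply/precP; exists j; split=> [i /eq_st //||].
  by move: nej sj; case: (odd j); case: (t j); case: (s j).
by move: sj; case: (odd j); case: (s j).
Qed.

Lemma prec_notP (s t : word2) : s <> t -> prec s t <-> ~ prec t s.
Proof.
by move=> neq; split=> [/prec_asym //|nts]; case: (prec_total neq).
Qed.

Lemma prec_head (s t : word2) : s 0 < t 0 -> prec s t.
Proof.
move=> lt; apply/precP; exists 0; split=> //; move: lt.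
  by case: (s 0); case: (t 0).
by case: (s 0); case: (t 0).
Qed.

(** Removing a common first letter moves the first difference by one place and so flips its
    parity. *)
Lemma prec_shift (s t : word2) :
  s 0 = t 0 -> prec s t <-> prec (shift t) (shift s).
Proof.
move=> eq0; split=> /precP[j [eq_st sj tj]]; apply/precP.
  case: j eq_st sj tj => [|j] eq_st sj tj; first by move: tj; rewrite -eq0 sj.
  exists j; split=> [i ltij||]; rewrite /shift ?sj ?tj ?negbK //=.
  by rewrite eq_st.
exists j.+1; split=> [[|i] //||].
- by rewrite ltnS => /eq_st.
- by rewrite [s _]tj.
- by rewrite [t _]sj negbK.
Qed.

Lemma prec_letter (s t : word2) : prec s t -> s 0 <= t 0.
Proof.
by move=> st; rewrite leqNgt; apply/negP => /prec_head; apply: prec_asym.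
Qed.

(** The first difference of [x] and [q] lies below [L], where [t] coincides with [q]. *)
Lemma prec_agree (L : nat) (x q t : word2) :
    (exists2 i, i < L & x i != q i) -> (forall i, i < L -> q i = t i) ->
  prec x q <-> prec x t.
Proof.
have half a b : (exists2 i, i < L & x i != a i) ->
    (forall i, i < L -> a i = b i) -> prec x a -> prec x b.
  case=> i ltiL nei ab /precP[j [xa xj aj]]; apply/precP.
  have ltjL : j < L.
    rewrite ltnNge; apply/negP => leLj.
    by rewrite xa ?eqxx // in nei; apply: leq_trans leLj.
  exists j; split=> [k ltkj||] //; last by rewrite -ab.
  by rewrite xa // ab // (ltn_trans ltkj).
move=> ne qt; split; apply: half => //.
  by case: ne => i ltiL; rewrite qt //; exists i.
by move=> i /qt.
Qed.

(** At every index [minw] has the letter that the smaller word carries at a first difference, so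
    0101... is the least word; dually [maxw], 1010..., is the greatest. *)
Definition minw : word2 := fun i => odd i.
Definition maxw : word2 := fun i => ~~ odd i.

Lemma minw_prec (t : word2) : t <> minw -> prec minw t.
Proof.
case/prec_total => // /precP[j [_ _]]; rewrite /minw.
by case: (odd j).
Qed.

Lemma prec_maxw (t : word2) : t <> maxw -> prec t maxw.
Proof.
case/prec_total => // /precP[j [_]]; rewrite /maxw.
by case: (odd j).
Qed.

Lemma iter_shiftE (i : nat) (s : word2) (k : nat) :
  iter i shift s k = s (i + k).
Proof.
elim: i k => [//|i IH] k; rewrite iterS /shift IH.
by rewrite addSn addnS.
Qed.

(* Comparing [t] with [u t] is comparing [t] with the fixed point
   [x = u u u ...] of [y |-> u y]: the first position where [t] and [u t]
   differ is the first one where [t] and [x] differ, and [u t] agrees with [x]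
   up to and including that position. *)
Lemma prec_fixpoint (p : nat) (t y x : word2) :
    0 < p -> (forall i, i < p -> y i = x i) ->
    (forall i, y (p + i) = t i) -> (forall i, x (p + i) = x i) ->
  [/\ t = y <-> t = x, prec t y <-> prec t x & prec y t <-> prec x t].
Proof.
move=> p0 yx yt xx.
(* Strong induction: past its first [p] letters [y] copies [t], which equals [y] below [j], so [y]
   repeats itself with the period of [x]. *)
have yxj j : (forall i, i < j -> t i = y i) -> forall i, i <= j -> y i = x i.
  move=> ty i; elim: {i}_.+1 {-2}i (ltnSn i) => // m IH i; rewrite ltnS => le_im leij.
  case: (ltnP i p) => [/yx //|lepi].
  rewrite -(subnKC lepi) yt xx ty; last by lia.
  by apply: IH; lia.
have yxj' j : (forall i, i < j -> t i = x i) -> forall i, i <= j -> y i = x i.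
  move=> tx i leij; case: (ltnP i p) => [/yx //|lepi].
  by rewrite -(subnKC lepi) yt xx tx //; lia.
split; split.
- move=> ty; apply: funext => i; rewrite [in LHS]ty; apply: (@yxj i) => // k _.
  by rewrite ty.
- move=> tx; apply: funext => i; rewrite [in LHS]tx; apply/esym/(@yxj' i) => // k _.
  by rewrite tx.
- case/precP=> j [ty tj yj]; apply/precP; exists j; have E := yxj _ ty.
  by split=> // [i ltij|]; rewrite -?E ?ty // ltnW.
- case/precP=> j [tx tj xj]; apply/precP; exists j; have E := yxj' _ tx.
  by split=> // [i ltij|]; rewrite ?E ?tx // ltnW.
- case/precP=> j [yt' yj tj]; apply/precP; exists j.
  have ty i : i < j -> t i = y i by move/yt'.
  have E := yxj _ ty.
  by split=> // [i ltij|]; rewrite -?E ?ty // ltnW.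
- case/precP=> j [xt xj tj]; apply/precP; exists j.
  have tx i : i < j -> t i = x i by move/xt.
  have E := yxj' _ tx.
  by split=> // [i ltij|]; rewrite ?E ?tx // ltnW.
Qed.

(** For empty [u] this is 000..., since [i %% 0] is [i] and [nth] returns its default. *)
Definition winf (u : seq bool) : word2 := fun i => nth false u (i %% size u).

Lemma winf_period (u : seq bool) (i : nat) : winf u (size u + i) = winf u i.
Proof. by rewrite /winf modnDl. Qed.

Lemma winf_periodM (u : seq bool) (m i : nat) :
  winf u (m * size u + i) = winf u i.
Proof. by rewrite /winf modnMDl. Qed.

Definition starts_with (s : word2) (w : seq bool) : Prop :=
  forall i, i < size w -> s i = nth false w i.

Lemma starts_with_suffix (s : word2) (w : seq bool) (k : nat) :
    starts_with s w -> k < size w ->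
  let t := iter (size w) shift s in let y := iter k shift s in
  let x := winf (drop k w) in
  [/\ t = y <-> t = x, prec t y <-> prec t x & prec y t <-> prec x t].
Proof.
move=> sw ltk /=; apply: (@prec_fixpoint (size w - k)).
- by rewrite subn_gt0.
- move=> i lti; rewrite iter_shiftE sw; last by lia.
  by rewrite /winf size_drop modn_small // nth_drop.
- by move=> i; rewrite !iter_shiftE addnA subnKC // ltnW.
- by move=> i; rewrite -size_drop winf_period.
Qed.

Definition wcat (w : seq bool) (t : word2) : word2 :=
  fun i => if i < size w then nth false w i else t (i - size w).

Lemma starts_with_wcat (w : seq bool) (t : word2) : starts_with (wcat w t) w.
Proof. by move=> i lti; rewrite /wcat lti. Qed.

Lemma iter_shift_wcat (w : seq bool) (t : word2) :
  iter (size w) shift (wcat w t) = t.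
Proof.
apply: funext => i; rewrite iter_shiftE /wcat ltnNge leq_addr /=.
by rewrite addKn.
Qed.

(** * Orbits and their patterns *)

(** Different first letters decide the order of two orbit points; equal ones reduce it to the
    reversed order of the next two points, until the later point is the last one. Only comparisons
    between letters of the same word enter, so that 0^N and 1^N can be compared too. *)
Lemma orbit_ext (N : nat) (s s' : word2) :
    (forall i j, i < N -> j < N -> (s i < s j) = (s' i < s' j)) ->
    (forall k, k < N -> iter N shift s <> iter k shift s) ->
    (forall k, k < N -> iter N shift s' <> iter k shift s') ->
    (forall k, k < N ->
       prec (iter k shift s) (iter N shift s) <->
       prec (iter k shift s') (iter N shift s')) ->
  forall i j, i <= N -> j <= N ->
    prec (iter i shift s) (iter j shift s) <->
    prec (iter i shift s') (iter j shift s').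
Proof.
move=> lts ds ds' last.
have main i j : i < j -> j <= N ->
    (prec (iter i shift s) (iter j shift s) <->
     prec (iter i shift s') (iter j shift s')) /\
    (prec (iter j shift s) (iter i shift s) <->
     prec (iter j shift s') (iter i shift s')).
  move=> ltij lejN; have [m] : exists m, j + m = N by exists (N - j); lia.
  elim: m i j ltij lejN => [|m IH] i j ltij lejN eqN.
    rewrite addn0 in eqN; rewrite {}eqN in ltij lejN *.
    have := last _ ltij; split=> //.
    rewrite prec_notP; last exact: ds.
    by rewrite [X in _ <-> X]prec_notP; [tauto | exact: ds'].
  have ltj : j < N by lia.
  have lti : i < N by lia.
  have h0 u k : iter k shift u 0 = u k by rewrite iter_shiftE addn0.
  have A := lts _ _ lti ltj; have B := lts _ _ ltj lti.
  case: (eqVneq (s i) (s j)) => [eqs|nes].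
    have eqs' : s' i = s' j.
      by move: A B; rewrite eqs; case: (s j); case: (s' i); case: (s' j).
    have [] := IH i.+1 j.+1; [lia | lia | lia |].
    rewrite !iterS => H1 H2.
    split; rewrite prec_shift ?h0 //; rewrite [X in _ <-> X]prec_shift ?h0 //.
  have [lt_ij|lt_ji] : s i < s j \/ s j < s i.
    by move: nes; case: (s i); case: (s j); [ | right| left |].
  - have P : prec (iter i shift s) (iter j shift s) by apply: prec_head; rewrite !h0.
    have Q : prec (iter i shift s') (iter j shift s').
      by apply: prec_head; rewrite !h0 -A.
    by split; split=> // R; [case: (prec_asym P) | case: (prec_asym Q)].
  - have P : prec (iter j shift s) (iter i shift s) by apply: prec_head; rewrite !h0.
    have Q : prec (iter j shift s') (iter i shift s').
      by apply: prec_head; rewrite !h0 -B.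
    by split; split=> // R; [case: (prec_asym P) | case: (prec_asym Q)].
move=> i j leiN lejN; case: (ltngtP i j) => [/main[] //|/main[] //|->].
by split=> /prec_irr.
Qed.

(** If the points [i < j] coincide, [N - j] further shifts make the last point coincide with an
    earlier one. *)
Lemma orbit_distinct (N : nat) (s : word2) :
    (forall k, k < N -> iter N shift s <> iter k shift s) ->
  forall i j : 'I_N.+1, i <> j -> iter i shift s <> iter j shift s.
Proof.
move=> ds; have main i j : i < j -> j <= N -> iter i shift s <> iter j shift s.
  move=> ltij lejN E; apply: (@ds (N - j + i)); first by lia.
  by rewrite iterD E -iterD subnK.
move=> i j neij; have lei := ltn_ord i; have lej := ltn_ord j.
case: (ltngtP i j) => [lt|lt|/val_inj //]; first by apply: main.
by move/esym; apply: main.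
Qed.

(** The value of a permutation at [i] is the number of indices with a smaller value. *)
Lemma perm_eq_order (n : nat) (p q : 'S_n) :
  (forall i j, p i < p j <-> q i < q j) -> p = q.
Proof.
have rk (r : 'S_n) i : #|[set j | r j < r i]| = r i.
  rewrite -[LHS](card_imset _ (@perm_inj _ r)).
  have -> : [set r x | x in [set j | r j < r i]] = [set v : 'I_n | v < r i].
    apply/setP => v; apply/imsetP/idP => [[x]|]; first by rewrite !inE => ? ->.
    by rewrite inE => lt; exists ((r^-1)%g v); rewrite ?inE permKV.
  rewrite -sum1_card (eq_bigl (fun v : 'I_n => v < r i)) => [|v]; last by rewrite inE.
  by rewrite -(big_ord_widen n (fun=> 1)) ?sum1_card ?card_ord // ltnW.
move=> pq; apply/permP => i; apply: val_inj; rewrite /= -(rk p) -(rk q).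
congr #|pred_of_set _|; apply/setP => j; rewrite !inE.
by apply/idP/idP => /pq.
Qed.

Lemma pattern_exists (n : nat) (s : word2) :
    (forall i j : 'I_n, i <> j -> iter i shift s <> iter j shift s) ->
  exists p : 'S_n, is_pat prec shift s p.
Proof.
move=> ds.
pose below (i : 'I_n) := [set j : 'I_n | `[< prec (iter j shift s) (iter i shift s) >]].
have lt_below i : #|below i| < n.
  rewrite -[X in _ < X]card_ord -cardsT proper_card // properT.
  by apply/eqP => /setP/(_ i); rewrite !inE => /asboolP/prec_irr.
pose r i := Ordinal (lt_below i).
have mono (i j : 'I_n) : prec (iter i shift s) (iter j shift s) -> r i < r j.
  move=> ij; apply: proper_card; apply/properP; split.
    apply/subsetP => k; rewrite !inE => /asboolP ki; apply/asboolP.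
    exact: prec_trans ki ij.
  by exists i; rewrite !inE; [apply/asboolP | apply/asboolP/prec_irr].
have injr : injective r.
  move=> i j eqr; apply: contrapT => /ds/prec_total[] /mono; rewrite eqr ltnn //.
exists (perm injr); split=> // i j; rewrite !permE; split; last exact: mono.
move=> ltr; case: (pselect (i = j)) => [eqij|/ds/prec_total[//|/mono]].
  by rewrite eqij ltnn in ltr.
by rewrite ltnNge ltnW.
Qed.

Lemma is_pat_eq (n : nat) (s s' : word2) (p q : 'S_n) :
    is_pat prec shift s p -> is_pat prec shift s' q ->
    (forall i j, i < n -> j < n ->
      prec (iter i shift s) (iter j shift s) <->
      prec (iter i shift s') (iter j shift s')) ->
  p = q.
Proof.
move=> [_ Hp] [_ Hq] E; apply: perm_eq_order => i j.
by rewrite Hp Hq; apply: E.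
Qed.

(** * Periodic and primitive words *)

Lemma nth_flatten_nseq (T : Type) (x0 : T) (m : nat) (u : seq T) (i : nat) :
  i < m * size u -> nth x0 (flatten (nseq m u)) i = nth x0 u (i %% size u).
Proof.
elim: m i => [//|m IH] i lti /=; rewrite nth_cat; case: ltnP => [ltiu|leui].
  by rewrite modn_small.
rewrite IH; last by lia.
by rewrite -{2}(subnKC leui) modnDl.
Qed.

Lemma size_flatten_nseq (T : Type) (m : nat) (u : seq T) :
  size (flatten (nseq m u)) = m * size u.
Proof. by elim: m => //= m IH; rewrite size_cat IH. Qed.

Lemma winf_flatten (m : nat) (u : seq bool) :
  0 < m -> winf (flatten (nseq m u)) = winf u.
Proof.
move=> m0; apply: funext => i; rewrite /winf size_flatten_nseq.
case: (posnP (size u)) => [/size0nil ->|u0].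
  by rewrite /= !nth_default // size_flatten_nseq muln0.
rewrite nth_flatten_nseq; last by rewrite ltn_mod muln_gt0 m0.
by rewrite modn_dvdm // dvdn_mull.
Qed.

Lemma period_mul (x : word2) (p : nat) :
  (forall i, x (p + i) = x i) -> forall m i, x (m * p + i) = x i.
Proof. by move=> xp; elim=> [//|m IH] i; rewrite mulSn -addnA xp IH. Qed.

(** By Bezout, [gcdn p q + a * q] is a multiple of [p] for some [a], and the extra shift by [a * q]
    changes no letter. *)
Lemma period_gcdn (x : word2) (p q : nat) :
    0 < p -> (forall i, x (p + i) = x i) -> (forall i, x (q + i) = x i) ->
  forall i, x (gcdn p q + i) = x i.
Proof.
move=> p0 xp xq i; have [a _ /dvdnP[b eqb]] := Bezoutl q p0.
rewrite -(period_mul xq a) addnA [a * q + _]addnC eqb.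
exact: period_mul.
Qed.

Lemma primitive_period (u : seq bool) (g : nat) :
    primitive_word u -> 0 < size u -> 0 < g -> g %| size u ->
    (forall i, winf u (g + i) = winf u i) ->
  g = size u.
Proof.
move=> primu u0 g0 dvdg xg; apply/eqP; rewrite eqn_leq dvdn_leq //=.
rewrite leqNgt; apply/negP => ltg; apply: primu.
have szt : size (take g u) = g by rewrite size_take ltg.
have sz : size u = size u %/ g * g by rewrite divnK.
exists (size u %/ g), (take g u); split.
- by rewrite ltn_divRL // mul1n.
- by rewrite szt.
- apply: (@eq_from_nth _ false); first by rewrite size_flatten_nseq szt.
  move=> i lti; rewrite nth_flatten_nseq szt -?sz // nth_take ?ltn_mod //.
  have wE k : k < size u -> winf u k = nth false u k.
    by move=> ltk; rewrite /winf modn_small.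
  rewrite -!wE //; last by rewrite (leq_ltn_trans (leq_mod _ _)).
  by rewrite {1}(divn_eq i g); apply: period_mul.
Qed.

(** The gcd of the two lengths is a period of the common infinite word; primitivity makes it equal
    to both lengths. *)
Lemma primitive_winf_inj (u v : seq bool) :
    primitive_word u -> primitive_word v -> 0 < size u -> 0 < size v ->
    winf u = winf v ->
  u = v.
Proof.
move=> primu primv u0 v0 E.
have xg : forall i, winf u (gcdn (size u) (size v) + i) = winf u i.
  apply: period_gcdn => // i; first exact: winf_period.
  by rewrite E winf_period.
have g0 : 0 < gcdn (size u) (size v) by rewrite gcdn_gt0 u0.
have gu := primitive_period primu u0 g0 (dvdn_gcdl _ _) xg.
have xg' : forall i, winf v (gcdn (size u) (size v) + i) = winf v i by rewrite -E.
have gv := primitive_period primv v0 g0 (dvdn_gcdr _ _) xg'.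
have szuv : size u = size v by rewrite -gu -{2}gv.
apply: (@eq_from_nth _ false) => // i lti.
have /(congr1 (@^~ i)) := E.
by rewrite /winf /= -szuv modn_small.
Qed.

(** If [drop k w] is a proper power of [u], its last block [u] is a shorter suffix of [w] with the
    same periodic word; the descent ends at a primitive suffix. *)
Lemma primitive_suffix (w : seq bool) (k : nat) : k < size w ->
  exists k', [/\ k' < size w, primitive_word (drop k' w)
                & winf (drop k' w) = winf (drop k w)].
Proof.
move: {2}(size w - k) (leqnn (size w - k)) => m.
elim: m k => [|m IH] k lem ltk; first by lia.
case: (pselect (primitive_word (drop k w))) => [prim|]; first by exists k.
move/contrapT => [d [u [d1 szu eq_w]]].
have szw : size w - k = d * size u by rewrite -size_drop eq_w size_flatten_nseq.
rewrite size_drop in szu.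
have u0 : 0 < size u by rewrite lt0n; apply/eqP => u0; move: szw; rewrite u0 muln0; lia.
have defu : drop (size w - size u) w = u.
  case: d d1 eq_w szw => // d d1 eq_w szw.
  rewrite -[in RHS](@drop_size_cat _ (d * size u) (flatten (nseq d u)) u) ?size_flatten_nseq //.
  have -> : flatten (nseq d u) ++ u = flatten (nseq d.+1 u).
    by elim: (d) => [|e IHe] /=; rewrite ?cats0 // -catA IHe.
  by rewrite -eq_w drop_drop; congr drop; rewrite mulSn in szw; lia.
have [] := IH (size w - size u); [lia | lia |].
move=> k' [ltk' prim E]; exists k'; split=> //.
by rewrite E defu eq_w winf_flatten // ltnW.
Qed.

(* Flipping a letter of [q] beyond the position where it separates from the
   other words of the finite family gives an immediate upper neighbour; a
   periodic word other than the maximal one can be raised arbitrarily far. *)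
Lemma just_above (I : finType) (pt : I -> word2) (u : seq bool) :
    0 < size u -> winf u <> maxw ->
  exists t, [/\ prec (winf u) t, forall l, pt l <> t
    & forall l, prec (pt l) t -> ~ prec (winf u) (pt l)].
Proof.
move=> u0 neq; set q := winf u.
have sep l : exists j, pt l <> q -> pt l j != q j.
  case: (pselect (pt l = q)) => [//|/word_neqP[j nej]]; last by exists j.
  by exists 0.
pose d l := sval (cid (sep l)).
have dP l : pt l <> q -> pt l (d l) != q (d l) by rewrite /d; case: cid.
pose L := (\max_l d l).+1.
have ltdL l : d l < L by rewrite ltnS; apply: leq_bigmax.
(* Otherwise [q] agrees with [maxw] from [L] on, hence everywhere by periodicity. Moving by [2 * L]
   periods passes [L] and keeps the parity of the index. *)
have [j leLj qj] : exists2 j, L <= j & q j = odd j.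
  apply: contrapT => nex; apply: neq; apply: funext => i.
  rewrite -(winf_periodM u (2 * L)) /maxw.
  have le : L <= 2 * L * size u + i by nia.
  have -> : odd i = odd (2 * L * size u + i).
    by rewrite oddD -mulnA oddM.
  apply/eqP/negPn/negP => ne; apply: nex; exists (2 * L * size u + i) => //.
  by move: ne; rewrite /q; case: (winf _ _); case: (odd _).
pose t : word2 := fun i => q i (+) (i == j).
have qt i : i < L -> q i = t i.
  by move=> lti; rewrite /t; case: eqP => [|_]; rewrite ?addbF //; lia.
have qltt : prec q t.
  apply/precP; exists j; split=> // [i ltij|]; last by rewrite /t eqxx qj addbT.
  by rewrite /t ltn_eqF // addbF.
exists t; split=> // l.
  move=> eqt; case: (pselect (pt l = q)) => [E|/dP].
    by apply: (prec_neq qltt); rewrite -eqt E.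
  by rewrite eqt qt ?eqxx.
move=> lt qlt; have neqq : pt l <> q by move/esym; apply: prec_neq.
have /prec_agree E : exists2 i, i < L & pt l i != q i.
  by exists (d l); [exact: ltdL | exact: dP].
by apply: (prec_asym qlt); apply/(E _ qt).
Qed.

Lemma arg_max_prec (I : finType) (pt : I -> word2) (P : I -> Prop) :
    (exists i, P i) ->
  exists2 i, P i & forall j, P j -> ~ prec (pt i) (pt j).
Proof.
case=> i0 Pi0.
pose rk i := #|[set l | `[< prec (pt l) (pt i) >]]|.
have Pi0' : `[< P i0 >] by apply/asboolP.
case: (@arg_maxnP _ i0 (fun i => `[< P i >]) rk Pi0') => i /asboolP Pi maxi.
exists i => // j /asboolP /maxi /=; rewrite /rk leqNgt => /negP le ij; apply: le.
apply: proper_card; apply/properP; split.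
  apply/subsetP => k; rewrite !inE => /asboolP ki; apply/asboolP.
  exact: prec_trans ki ij.
by exists i; rewrite !inE; [apply/asboolP | apply/asboolP/prec_irr].
Qed.

(** * Patterns with a given prefix *)

Definition patterns_of (N : nat) (w : seq bool) : {set 'S_N.+1} :=
  [set p | `[< exists s, starts_with s w /\ is_pat prec shift s p >]].

Lemma patterns_ofP (N : nat) (w : seq bool) (p : 'S_N.+1) :
  reflect (exists s, starts_with s w /\ is_pat prec shift s p)
          (p \in patterns_of N w).
Proof. by rewrite inE; apply: asboolP. Qed.

Lemma pattern_distinct (N : nat) (s : word2) (p : 'S_N.+1) :
    is_pat prec shift s p ->
  forall k, k < N -> iter N shift s <> iter k shift s.
Proof.
move=> [ds _] k ltk; apply: (ds ord_max (Ordinal (leqW ltk))).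
by move/(congr1 val) => /=; lia.
Qed.

Lemma pattern_tail (N : nat) (w : N.-tuple bool) (s : word2) (p : 'S_N.+1) :
    starts_with s w -> is_pat prec shift s p ->
  forall k, k < N -> winf (drop k w) <> iter N shift s.
Proof.
move=> sw sp k ltk E; apply: (pattern_distinct sp ltk).
have [] := starts_with_suffix sw (k := k); first by rewrite size_tuple.
by rewrite size_tuple => -[_ H] _ _; apply: H.
Qed.

Lemma pattern_of_tail (N : nat) (w : N.-tuple bool) (t : word2) :
    (forall k, k < N -> winf (drop k w) <> t) ->
  exists p : 'S_N.+1, is_pat prec shift (wcat w t) p.
Proof.
move=> dt; apply/pattern_exists/orbit_distinct => k ltk E.
have [] := @starts_with_suffix (wcat w t) w k (@starts_with_wcat w t).
  by rewrite size_tuple.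
rewrite size_tuple => -[H _] _ _; apply: (dt k ltk); rewrite -H //.
by rewrite -[in X in iter X](size_tuple w) iter_shift_wcat.
Qed.

(** With a common prefix the letters agree, so by [orbit_ext] only the place of the last orbit point
    matters, and that is its place among the periodic points. *)
Lemma pattern_same_tail (N : nat) (w : N.-tuple bool) (s s' : word2)
    (p q : 'S_N.+1) :
    starts_with s w -> starts_with s' w ->
    is_pat prec shift s p -> is_pat prec shift s' q ->
  p = q <-> (forall k, k < N -> prec (winf (drop k w)) (iter N shift s) <->
                                prec (winf (drop k w)) (iter N shift s')).
Proof.
move=> sw sw' sp sq.
have fix_ (u : word2) k : starts_with u w -> k < N ->
    prec (iter k shift u) (iter N shift u) <-> prec (winf (drop k w)) (iter N shift u).
  move=> uw ltk; have [] := starts_with_suffix uw (k := k).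
    by rewrite size_tuple.
  by rewrite size_tuple.
split=> [eqpq k ltk|E].
  rewrite -!fix_ //; have lek := leqW ltk.
  case: sp => _ /(_ (Ordinal lek) ord_max) /= <-.
  by case: sq => _ /(_ (Ordinal lek) ord_max) /= <-; rewrite eqpq.
apply: (is_pat_eq sp sq) => i j lti ltj; apply: (@orbit_ext N) => //.
- by move=> k l ltk ltl; rewrite !sw ?sw' ?size_tuple.
- exact: pattern_distinct sp.
- exact: pattern_distinct sq.
- by move=> k ltk; rewrite !fix_ //; apply: E.
Qed.

Lemma primitive2 (a b : bool) : a != b -> primitive_word [:: a; b].
Proof.
move=> ne [m [u [m1 szu E]]]; have := congr1 size E.
rewrite size_flatten_nseq /= => sz; have sz1 : size u = 1 by nia.
have m2 : m = 2 by nia.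
case: u sz1 E {szu sz} => [|c [|]] //= _; rewrite m2 /= => -[ac bc].
by rewrite ac bc eqxx in ne.
Qed.

Lemma primitive1 (a : bool) : primitive_word [:: a].
Proof.
move=> [m [u [m1 szu E]]]; have := congr1 size E.
by rewrite size_flatten_nseq /=; move: szu => /=; case: (size u); lia.
Qed.

Lemma winf2 (a : bool) : winf [:: a; ~~ a] = fun i => odd i (+) a.
Proof. by apply: funext => i; rewrite /winf modn2; case: (odd i). Qed.

(** The alternating words, [minw] for [a = false] and [maxw] for [a = true], have a primitive root
    of length 2, and a primitive suffix with that periodic word must be this root. *)
Lemma suffix2_point (N : nat) (w : N.-tuple bool) (a : bool) : 2 <= N ->
  (exists2 k, k < N & winf (drop k w) = fun i => odd i (+) a) <->
  drop (N - 2) w = [:: a; ~~ a].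
Proof.
move=> N2; split=> [[k ltk E]|E]; last first.
  by exists (N - 2); [lia | rewrite E winf2].
have [|k' [ltk' prim E']] := @primitive_suffix w k; first by rewrite size_tuple.
rewrite size_tuple in ltk'.
have D : drop k' w = [:: a; ~~ a].
  apply: primitive_winf_inj => //; first by apply: primitive2; case: (a).
    by rewrite size_drop size_tuple subn_gt0.
  by rewrite E' E winf2.
rewrite -D; congr drop; have := congr1 size D.
by rewrite size_drop size_tuple /=; lia.
Qed.

Definition prim_suffixes (N : nat) (w : seq bool) : {set 'I_N} :=
  [set k : 'I_N | `[< primitive_word (drop k w) >]].

(* The words [t] that avoid the points [winf (drop k w)] are split into classes
   by these points.  A class is labelled by the largest point below it ([Some
   k], with [drop k w] primitive), or by [None] when no point is below it. *)
Definition class_labels (N : nat) (w : seq bool) : {set option 'I_N} :=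
  [set e | if e is Some k
           then (k \in prim_suffixes N w) && `[< winf (drop k w) <> maxw >]
           else `[< forall k, k < N -> winf (drop k w) <> minw >]].

Definition in_class (N : nat) (w : seq bool) (e : option 'I_N) (t : word2) :
    Prop :=
  (forall l, l < N -> winf (drop l w) <> t) /\
  if e is Some k
  then prec (winf (drop k w)) t /\ forall l, l < N ->
         prec (winf (drop l w)) t -> ~ prec (winf (drop k w)) (winf (drop l w))
  else forall l, l < N -> ~ prec (winf (drop l w)) t.

(** A point other than [maxw] has a word immediately above it; for [None] the word [minw] itself
    serves. *)
Lemma in_class_witness (N : nat) (w : N.-tuple bool) (e : option 'I_N) :
  e \in class_labels N w -> exists t, in_class w e t.
Proof.
rewrite inE; case: e => [k /andP[_ /asboolP nmax]|/asboolP nmin].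
  have u0 : 0 < size (drop k w) by rewrite size_drop size_tuple subn_gt0.
  have [t [kt dt ct]] := just_above (fun l : 'I_N => winf (drop l w)) u0 nmax.
  exists t; split=> [l ltl|]; first exact: (dt (Ordinal ltl)).
  by split=> // l ltl; apply: (ct (Ordinal ltl)).
exists minw; split=> // l ltl; apply: prec_asym; apply: minw_prec.
exact: nmin.
Qed.

Lemma in_class_cover (N : nat) (w : N.-tuple bool) (t : word2) :
    (forall l, l < N -> winf (drop l w) <> t) ->
  exists2 e, e \in class_labels N w & in_class w e t.
Proof.
move=> dt.
case: (pselect (exists l : 'I_N, prec (winf (drop l w)) t)) => [ex|nex].
  have [l lt maxl] := arg_max_prec (fun l : 'I_N => winf (drop l w)) ex.
  have [|k' [ltk' prim E]] := @primitive_suffix w l; first by rewrite size_tuple.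
  rewrite size_tuple in ltk'.
  exists (Some (Ordinal ltk')).
    rewrite !inE; apply/andP; split; apply/asboolP => //=; rewrite E => eqmax.
    by rewrite eqmax in lt; apply: (prec_asym lt); apply: prec_maxw => /esym; apply: prec_neq.
  split=> //=; rewrite E; split=> // j ltj; exact: (maxl (Ordinal ltj)).
exists None; last first.
  by split=> // l ltl lt; apply: nex; exists (Ordinal ltl).
rewrite inE; apply/asboolP => k ltk E; apply: nex; exists (Ordinal ltk) => /=.
by rewrite E; apply: minw_prec => tE; apply: (dt k ltk); rewrite E tE.
Qed.

Lemma in_class_same (N : nat) (w : seq bool) (e : option 'I_N)
    (t t' : word2) (l : nat) :
    in_class w e t -> in_class w e t' -> l < N ->
  prec (winf (drop l w)) t -> prec (winf (drop l w)) t'.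
Proof.
case: e => [k|] [_ C] [_ C'] ltl lt; last by case: (C l ltl).
case: C C' => kt C [kt' C'].
case: (pselect (winf (drop l w) = winf (drop k w))) => [->//|/prec_total[lk|]].
  exact: prec_trans lk kt'.
by move/(C l ltl lt).
Qed.

(** The set of points below a word determines the largest of them, and this point determines its
    primitive suffix. *)
Lemma in_class_inj (N : nat) (w : N.-tuple bool) (e e' : option 'I_N)
    (t t' : word2) :
    e \in class_labels N w -> e' \in class_labels N w ->
    in_class w e t -> in_class w e' t' ->
    (forall l, l < N -> prec (winf (drop l w)) t <-> prec (winf (drop l w)) t') ->
  e = e'.
Proof.
case: e e' => [k|] [k'|] //; rewrite !inE => L L' [_ C] [_ C'] S.
- case: C C' => kt C [kt' C']; congr Some; apply: val_inj => /=.
  have /S kt2 := kt => //; have kt2' : prec (winf (drop k' w)) t by apply/S.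
  have E : winf (drop k w) = winf (drop k' w).
    apply: contrapT => /prec_total[]; first by apply: C.
    by apply: C' => //; apply: kt2.
  case/andP: L => /asboolP prim _; case/andP: L' => /asboolP prim' _.
  have D : drop k w = drop k' w.
    by apply: primitive_winf_inj; rewrite // size_drop size_tuple subn_gt0.
  have := congr1 size D; rewrite !size_drop !size_tuple.
  by have := ltn_ord k; have := ltn_ord k'; lia.
- by case: C => kt _; case: (C' k) => //; apply/S.
- by case: C' => kt _; case: (C k') => //; apply/S.
Qed.

Lemma card_patterns_of_labels (N : nat) (w : N.-tuple bool) :
  #|patterns_of N w| = #|class_labels N w|.
Proof.
have szw := size_tuple w.
have tailE t : iter N shift (wcat w t) = t by rewrite -[in X in iter X]szw iter_shift_wcat.
(* The implication makes the choice function [F] total; off the labels its value is the arbitrary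
   [1%g]. *)
have ex (e : option 'I_N) : exists p : 'S_N.+1, e \in class_labels N w ->
    exists t, in_class w e t /\ is_pat prec shift (wcat w t) p.
  case: (boolP (e \in _)) => [eL|_]; last by exists 1%g.
  have [t ct] := in_class_witness eL.
  by have [p pt] := pattern_of_tail ct.1; exists p => _; exists t.
pose F e := sval (cid (ex e)).
have FP e : e \in class_labels N w ->
    exists t, in_class w e t /\ is_pat prec shift (wcat w t) (F e).
  by rewrite /F; case: cid.
have -> : patterns_of N w = F @: class_labels N w.
  apply/setP => p; apply/patterns_ofP/imsetP => [[s [sw sp]]|[e eL ->]].
    have [e eL ce] := in_class_cover (pattern_tail sw sp).
    exists e => //; have [t [ct pt]] := FP _ eL.
    apply/(pattern_same_tail sw (@starts_with_wcat w t) sp pt) => k ltk.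
    by rewrite tailE; split; [apply: in_class_same ce ct ltk | apply: in_class_same ct ce ltk].
  have [t [_ pt]] := FP _ eL; exists (wcat w t); split=> //.
  exact: starts_with_wcat.
apply: card_in_imset => e e' eL eL' eqF.
have [t [ct pt]] := FP _ eL; have [t' [ct' pt']] := FP _ eL'.
apply: (in_class_inj eL eL' ct ct').
have [+ _] := pattern_same_tail (@starts_with_wcat w t) (@starts_with_wcat w t') pt pt'.
by move/(_ eqF); rewrite !tailE.
Qed.

(** Each primitive suffix gives a label, and [None] is one more. A final 10 makes [maxw] a point
    with nothing above it, and a final 01 makes [minw] a point with nothing below it; each costs one
    label. *)
Lemma card_class_labels (N : nat) (w : N.-tuple bool) : 2 <= N ->
  #|class_labels N w| + (drop (N - 2) w == [:: true; false])
    + (drop (N - 2) w == [:: false; true]) = #|prim_suffixes N w|.+1.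
Proof.
move=> N2.
pose B := [set k in prim_suffixes N w | `[< winf (drop k w) <> maxw >]].
have cardB : #|B| + (drop (N - 2) w == [:: true; false]) = #|prim_suffixes N w|.
  have maxE : maxw = (fun i => odd i (+) true).
    by apply: funext => i; rewrite /maxw addbT.
  have ltN : N - 2 < N by lia.
  case: eqP => [E|nE]; last first.
    rewrite addn0; congr #|pred_of_set _|; apply/setP => k; rewrite inE.
    apply: andb_idr => _; apply/asboolP => E; apply: nE.
    by apply/(suffix2_point w true N2); exists k; rewrite // E.
  have kA : Ordinal ltN \in prim_suffixes N w.
    by rewrite inE; apply/asboolP; rewrite /= E; apply: primitive2.
  rewrite (cardsD1 (Ordinal ltN) (prim_suffixes N w)) kA addnC; congr (_ + _).
  congr #|pred_of_set _|; apply/setP => k; rewrite !inE.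
  apply/andP/andP => -[] => [prim /asboolP nmax|nk /asboolP prim]; split=> //.
  - by apply/eqP => ek; apply: nmax; rewrite ek /= E maxE -winf2.
  - exact/asboolP.
  apply/asboolP => Emax; case/eqP: nk; apply: val_inj => /=.
  have D : drop k w = [:: true; ~~ true].
    apply: primitive_winf_inj => //; first exact: primitive2.
      by rewrite size_drop size_tuple subn_gt0.
    by rewrite winf2 Emax maxE.
  have := congr1 size D; rewrite size_drop size_tuple /=.
  by have := ltn_ord k; lia.
have cardL : #|class_labels N w| = (None \in class_labels N w) + #|B|.
  rewrite (cardsD1 None); congr (_ + _).
  rewrite -(card_imset B (@Some_inj _)); congr #|pred_of_set _|.
  apply/setP => -[k|]; rewrite !inE /=.
    rewrite mem_imset; last exact: Some_inj.
    by rewrite !inE.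
  by apply/esym/imsetP => -[].
have NoneE : (None \in class_labels N w) + (drop (N - 2) w == [:: false; true]) = 1.
  rewrite inE.
  have minE : minw = (fun i => odd i (+) false).
    by apply: funext => i; rewrite /minw addbF.
  case: eqP => [/(suffix2_point w false N2)[k ltk E]|nE].
    by case: asboolP => // /(_ k ltk); rewrite minE.
  rewrite addn0; case: asboolP => // nex; exfalso; apply: nex => k ltk E; apply: nE.
  by apply/(suffix2_point w false N2); exists k; rewrite // E.
by rewrite cardL -cardB; lia.
Qed.

(** * Patterns with several prefixes *)

(* If a relation on the indices [0 .. M.+2] is reversed by the successor map,
   then the indices spiral inwards or outwards, according to the place of the
   last one. *)
Lemma spiral_in (M : nat) (R : nat -> nat -> Prop) :
    (forall i, ~ R i i) -> (forall i j k, R i j -> R j k -> R i k) ->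
    (forall i j, i < M.+2 -> j < M.+2 -> R i j -> R j.+1 i.+1) ->
    R M.+2 M ->
  forall m, m <= M.+1 ->
    if odd m then ~ R (M.+1 - m) M else ~ R M.+1 (M.+1 - m).
Proof.
move=> irr trans D RNM; elim=> [|m IH] lem; first exact: irr.
have := IH (ltnW lem).
have -> : M.+1 - m = (M.+1 - m.+1).+1 by lia.
rewrite oddS; case: (odd m) => /= nR r; apply: nR.
  by apply: trans RNM; apply: D r; lia.
by apply: D r; lia.
Qed.

Lemma spiral_out (M : nat) (R : nat -> nat -> Prop) :
    (forall i, ~ R i i) -> (forall i j k, R i j -> R j k -> R i k) ->
    (forall i j, i < M.+2 -> j < M.+2 -> R i j -> R j.+1 i.+1) ->
    R M M.+2 -> ~ R M M.+1 ->
  forall m, m <= M.+1 -> ~ R (M.+1 - m) M.+1 /\ ~ R M (M.+1 - m).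
Proof.
move=> irr trans D RMN nR; elim=> [|m IH] lem; first by rewrite subn0; split.
have := IH (ltnW lem).
have -> : M.+1 - m = (M.+1 - m.+1).+1 by lia.
(* Since the successor map reverses [R], each of the two bounds at an index follows from the other
   bound at the next index. *)
case=> n1 n2; split=> r.
  by apply: n2; apply: trans RMN _; apply: D r; lia.
by apply: n1; apply: D r; lia.
Qed.

Lemma iter_shift0 (s : word2) (i : nat) : iter i shift s 0 = s i.
Proof. by rewrite iter_shiftE addn0. Qed.

Lemma not_prec_letter (s : word2) (i j : nat) :
  ~ prec (iter i shift s) (iter j shift s) -> s j <= s i.
Proof.
by move=> h; rewrite leqNgt; apply/negP => lt; apply: h; apply: prec_head; rewrite !iter_shift0.
Qed.

Lemma starts_with_take (s : word2) (N : nat) : starts_with s (mkseq s N).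
Proof. by move=> i; rewrite size_mkseq => lti; rewrite nth_mkseq. Qed.

Lemma drop_mkseq2 (s : word2) (M : nat) :
  drop M (mkseq s M.+2) = [:: s M; s M.+1].
Proof.
rewrite /mkseq -map_drop drop_iota add0n.
by have -> : M.+2 - M = 2 by lia.
Qed.

Lemma drop_mkseq1 (s : word2) (M : nat) :
  drop M.+1 (mkseq s M.+2) = [:: s M.+1].
Proof.
rewrite /mkseq -map_drop drop_iota add0n.
by have -> : M.+2 - M.+1 = 1 by lia.
Qed.

(** The prefix length is written [M.+2], so that its last two letters sit at [M] and [M.+1]; the
    indices below [M.+2] are those whose successor is still in the orbit. *)
Definition decreasing_orbit (M : nat) (s : word2) : Prop :=
  forall i j, i < M.+2 -> j < M.+2 -> prec (iter i shift s) (iter j shift s) ->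
    prec (iter j.+1 shift s) (iter i.+1 shift s).

(** Equal last letters give both suffixes the same periodic word. Different ones make the periodic
    word of the last two letters extreme, which fixes the side of point [M] on which the tail lies;
    the decreasing shift puts the tail on the opposite side of point [M.+1]. The pattern therefore
    shows whether the two letters are equal. *)
Lemma last_two_equal (M : nat) (s : word2) :
    decreasing_orbit M s ->
    (forall k, k < M.+2 -> iter M.+2 shift s <> iter k shift s) ->
  s M = s M.+1 <->
  (prec (iter M.+2 shift s) (iter M shift s) <->
   prec (iter M.+2 shift s) (iter M.+1 shift s)).
Proof.
move=> D ds; have W := @starts_with_take s M.+2.
have [] := starts_with_suffix W (k := M); first by rewrite size_mkseq.
rewrite size_mkseq drop_mkseq2 => E0 E1 E2.
have [] := starts_with_suffix W (k := M.+1); first by rewrite size_mkseq.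
rewrite size_mkseq drop_mkseq1 => F0 F1 F2.
split=> [eqs|H].
  rewrite E1 F1 eqs -[[:: _; _]]/(flatten (nseq 2 [:: s M.+1])) winf_flatten //.
have nE : iter M.+2 shift s <> winf [:: s M; s M.+1].
  by move/E0; apply: ds; lia.
case: (boolP (s M == s M.+1)) => [/eqP //|nes]; exfalso.
have sE : s M.+1 = ~~ s M by move: nes; case: (s M); case: (s M.+1).
rewrite sE winf2 in E1 E2 nE.
case sM: (s M) in sE E1 E2 nE.
  have NM : prec (iter M.+2 shift s) (iter M shift s).
    rewrite E1; have -> : (fun i => odd i (+) true) = maxw by apply: funext => i; rewrite addbT.
    by apply: prec_maxw => E; apply: nE; rewrite E; apply: funext => i; rewrite addbT.
  have /D : prec (iter M.+1 shift s) (iter M shift s).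
    by apply: prec_head; rewrite !iter_shift0 sM sE.
  by move/(_ (ltnSn _) (ltnW (ltnSn _)))/prec_asym; apply; apply/H.
have MN : prec (iter M shift s) (iter M.+2 shift s).
  rewrite E2; have -> : (fun i => odd i (+) false) = minw by apply: funext => i; rewrite addbF.
  by apply: minw_prec => E; apply: nE; rewrite E; apply: funext => i; rewrite addbF.
have /D : prec (iter M shift s) (iter M.+1 shift s).
  by apply: prec_head; rewrite !iter_shift0 sM sE.
by move/(_ (ltnW (ltnSn _)) (ltnSn _)) => /H; apply: prec_asym.
Qed.

(** Letters are monotone along the order. An outward spiral has the points [M] and [M.+1] as its
    extremes, and their equal letters force a constant prefix; an inward spiral puts the points
    alternately on the two sides, which forces an alternating prefix. *)
Lemma decreasing_orbit_word (M : nat) (s : word2) :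
    decreasing_orbit M s ->
    (forall i j, i < j <= M.+2 -> iter i shift s <> iter j shift s) ->
  forall m, m <= M.+1 ->
    s (M.+1 - m) = (if s M == s M.+1 then s M.+1 else odd m (+) s M.+1).
Proof.
move=> D ds.
have dN k : k < M.+2 -> iter M.+2 shift s <> iter k shift s.
  by move=> ltk /esym; apply: ds; rewrite ltk /=.
have irr i : ~ prec (iter i shift s) (iter i shift s) by apply: prec_irr.
have trans i j k : prec (iter i shift s) (iter j shift s) ->
    prec (iter j shift s) (iter k shift s) -> prec (iter i shift s) (iter k shift s).
  exact: prec_trans.
(* The opposite order satisfies the same hypotheses, so the spiral lemmas serve for both
   orientations. *)
have trans' i j k : prec (iter j shift s) (iter i shift s) ->
    prec (iter k shift s) (iter j shift s) -> prec (iter k shift s) (iter i shift s).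
  by move=> h1 h2; apply: trans h2 h1.
have D' i j : i < M.+2 -> j < M.+2 -> prec (iter j shift s) (iter i shift s) ->
    prec (iter i.+1 shift s) (iter j.+1 shift s).
  by move=> h1 h2; apply: D.
have ltM : M < M.+2 by lia.
have L := last_two_equal D dN.
have tot0 := prec_total (dN M ltM).
have tot1 := prec_total (dN M.+1 (ltnSn _)).
have ne01 : iter M shift s <> iter M.+1 shift s by apply: ds; lia.
case: eqP => [eqs m lem|nes].
  have H := L.1 eqs.
  case: (prec_total ne01) => h01.
    have hN := D _ _ ltM (ltnSn _) h01.
    have [] := spiral_out (R := fun i j => prec (iter j shift s) (iter i shift s))
      irr trans' D' _ _ lem; [by apply/H | exact: prec_asym |].
    move=> /not_prec_letter h1 /not_prec_letter.
    by rewrite eqs; move: h1; case: (s _); case: (s _).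
  have hN := D _ _ (ltnSn _) ltM h01.
  have [] := spiral_out (R := fun i j => prec (iter i shift s) (iter j shift s))
      irr trans D _ _ lem; [ | exact: prec_asym |].
    by case: tot0 => // /H /prec_asym [].
  move=> /not_prec_letter h1 /not_prec_letter.
  by rewrite eqs; move: h1; case: (s _); case: (s _).
have sE : s M = ~~ s M.+1 by move: nes; case: (s M); case: (s M.+1).
have {}L : ~ (prec (iter M.+2 shift s) (iter M shift s) <->
         prec (iter M.+2 shift s) (iter M.+1 shift s)) by move/L.
move=> m lem; case sM: (s M.+1) in sE *.
  have h01 : prec (iter M shift s) (iter M.+1 shift s).
    by apply: prec_head; rewrite !iter_shift0 sM sE.
  have hN := D _ _ ltM (ltnSn _) h01.
  have hM : prec (iter M shift s) (iter M.+2 shift s).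
    by case: tot0 => // h; case: L.
  have := spiral_in (R := fun i j => prec (iter j shift s) (iter i shift s))
    irr trans' D' hM lem.
  by case: (odd m) => /not_prec_letter; rewrite ?sE ?sM /=; case: (s _).
have h01 : prec (iter M.+1 shift s) (iter M shift s).
  by apply: prec_head; rewrite !iter_shift0 sM sE.
have hN := D _ _ (ltnSn _) ltM h01.
have hM : prec (iter M.+2 shift s) (iter M shift s).
  case: tot0 => // h; case: L; split=> h'; first by case: (prec_asym h).
  by case: (prec_asym hN).
have := spiral_in (R := fun i j => prec (iter i shift s) (iter j shift s))
  irr trans D hM lem.
by case: (odd m) => /not_prec_letter; rewrite ?sE ?sM /=; case: (s _).
Qed.

Lemma orbit_order (N : nat) (s s' : word2) (p : 'S_N.+1) :
    is_pat prec shift s p -> is_pat prec shift s' p ->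
  forall i j, i <= N -> j <= N ->
    prec (iter i shift s) (iter j shift s) <->
    prec (iter i shift s') (iter j shift s').
Proof.
move=> [_ P] [_ P'] i j lei lej.
have := P (Ordinal (lei : i < N.+1)) (Ordinal (lej : j < N.+1)).
by have := P' (Ordinal (lei : i < N.+1)) (Ordinal (lej : j < N.+1)) => /= <- <-.
Qed.

(* The letters of a word are nondecreasing along the order of its orbit, and
   the shift reverses the order of two orbit points with the same first letter.
   Two codings of the same pattern that disagree at [a] therefore allow a
   comparison through [a] of points whose letters differ in both codings. *)
Lemma decreasing_of_two_codings (M a : nat) (s s' : word2) (p : 'S_M.+3) :
    is_pat prec shift s p -> is_pat prec shift s' p ->
    a < M.+2 -> s a < s' a ->
  decreasing_orbit M s.
Proof.
move=> sp sp' lta lt_a i j lti ltj ij; have E := orbit_order sp sp'.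
have step (u : word2) k l : u k = u l -> prec (iter k shift u) (iter l shift u) ->
    prec (iter l.+1 shift u) (iter k.+1 shift u).
  by move=> ukl; rewrite prec_shift ?iter_shift0.
have step' k l : k < M.+2 -> l < M.+2 -> s' k = s' l ->
    prec (iter k shift s) (iter l shift s) ->
    prec (iter l.+1 shift s) (iter k.+1 shift s).
  by move=> ltk ltl ukl /E h; apply/E => //; apply: step => //; apply: h; exact: ltnW.
have le_s := prec_letter ij; rewrite !iter_shift0 in le_s.
have le_s' := prec_letter ((E i j (ltnW lti) (ltnW ltj)).1 ij).
rewrite !iter_shift0 in le_s'.
case: (eqVneq (s i) (s j)) => [eqs|nes]; first exact: step.
case: (eqVneq (s' i) (s' j)) => [eqs|nes']; first exact: step'.
have [si sj si' sj'] : [/\ s i = false, s j = true, s' i = false & s' j = true].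
  by move: le_s le_s' nes nes'; case: (s i); case: (s j); case: (s' i); case: (s' j).
have [sa sa'] : s a = false /\ s' a = true.
  by move: lt_a; case: (s a); case: (s' a).
(* In [s'] the letters at [a] and [j] are equal, and in [s] those at [i] and [a]; the order of each
   pair is read off in the other coding. *)
apply: (@prec_trans _ (iter a.+1 shift s)).
  apply: step'; rewrite ?sa' //.
  by apply: prec_head; rewrite !iter_shift0 sa sj.
apply: step; first by rewrite si sa.
apply/E; [exact: ltnW | exact: ltnW |].
by apply: prec_head; rewrite !iter_shift0 si' sa'.
Qed.

(** Both prefixes are constant or alternating. The pattern shows which, and in the alternating case
    also the last letter; hence only constant prefixes can differ. *)
Lemma two_codings (M : nat) (s s' : word2) (p : 'S_M.+3) :
    is_pat prec shift s p -> is_pat prec shift s' p ->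
    (exists2 a, a < M.+2 & s a < s' a) ->
  forall i, i < M.+2 -> s' i = true.
Proof.
move=> sp sp' [a lta lt_a]; have E := orbit_order sp sp'.
have D := decreasing_of_two_codings sp sp' lta lt_a.
have D' : decreasing_orbit M s'.
  by move=> i j lti ltj /E h; apply/E => //; apply: D => //; apply: h; exact: ltnW.
have dist (u : word2) : is_pat prec shift u p ->
    forall i j, i < j <= M.+2 -> iter i shift u <> iter j shift u.
  move=> [du _] i j /andP[ltij lej].
  have lti : i < M.+3 by lia.
  apply: (du (Ordinal lti) (Ordinal (lej : j < M.+3))).
  by move/(congr1 val) => /=; lia.
have S := decreasing_orbit_word D (dist _ sp).
have S' := decreasing_orbit_word D' (dist _ sp').
have L := last_two_equal D (pattern_distinct sp).
have L' := last_two_equal D' (pattern_distinct sp').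
have ltM : M < M.+2 by lia.
have eqL : (s M == s M.+1) = (s' M == s' M.+1).
  apply/eqP/eqP => [/L H|/L' H].
    by apply/L'; rewrite -!E //; lia.
  by apply/L; rewrite !E //; lia.
have aE : a = M.+1 - (M.+1 - a) by lia.
have le_ : M.+1 - a <= M.+1 by lia.
have Sa := S _ le_; have Sa' := S' _ le_; rewrite -aE in Sa Sa'.
case C: (s' M == s' M.+1) in eqL Sa' S' *.
  move=> i lti; have iE : i = M.+1 - (M.+1 - i) by lia.
  rewrite iE S' -?Sa'; last by lia.
  by move: lt_a; case: (s a); case: (s' a).
have hd (u : word2) : u M != u M.+1 ->
    u M.+1 <-> prec (iter M shift u) (iter M.+1 shift u).
  move=> nu; split=> [h|/prec_letter].
    by apply: prec_head; rewrite !iter_shift0; move: nu; rewrite h; case: (u M).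
  by rewrite !iter_shift0; move: nu; case: (u M); case: (u M.+1).
have e : s M.+1 = s' M.+1.
  by apply/idP/idP; rewrite !hd ?eqL ?C // E //; lia.
by move: lt_a; rewrite Sa Sa' eqL e ltnn.
Qed.

Lemma winf_nseq (m : nat) (b : bool) : 0 < m -> winf (nseq m b) = fun=> b.
Proof.
by move=> m0; apply: funext => i; rewrite /winf nth_nseq size_nseq ltn_mod m0.
Qed.

Lemma drop_nseq_tuple (N k : nat) (b : bool) :
  drop k (nseq_tuple N b) = nseq (N - k) b.
Proof. exact: drop_nseq. Qed.

(* A constant prefix [b ... b] followed by [t] gives an outward spiral that
   depends only on the side of [b b b ...] on which [t] lies. *)
Lemma patterns_of_nseq_sub (N : nat) (b c : bool) :
  patterns_of N (nseq_tuple N b) \subset patterns_of N (nseq_tuple N c).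
Proof.
apply/subsetP => p /patterns_ofP[s [sw sp]].
(* An extreme word differs from every constant word and lies on a known side of it, here the side of
   the old tail. *)
pose t := if `[< prec (fun=> b) (iter N shift s) >] then maxw else minw.
have dt' k : k < N -> winf (drop k (nseq_tuple N c)) <> t.
  move=> ltk; rewrite drop_nseq_tuple winf_nseq ?subn_gt0 // /t => E.
  have := congr1 (@^~ 0) E; have := congr1 (@^~ 1) E.
  by rewrite /maxw /minw; case: asboolP => _ /= ->.
have [q qt] := pattern_of_tail dt'.
apply/patterns_ofP; exists (wcat (nseq_tuple N c) t); split.
  exact: starts_with_wcat.
suff -> : p = q by [].
apply: (is_pat_eq sp qt) => i j lti ltj; apply: (@orbit_ext N) => //.
- move=> k l ltk ltl; have W := @starts_with_wcat (nseq_tuple N c) t.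
  by rewrite !sw ?W ?size_tuple // !nth_nseq ltk ltl !ltnn.
- exact: pattern_distinct sp.
- exact: pattern_distinct qt.
move=> k ltk; have ltk' (d : bool) : k < size (nseq_tuple N d) by rewrite size_tuple.
have [_ _] := starts_with_suffix sw (ltk' b).
have [_ _] := starts_with_suffix (@starts_with_wcat (nseq_tuple N c) t) (ltk' c).
rewrite iter_shift_wcat !size_tuple => H1 H2.
have tE : iter N shift (wcat (nseq_tuple N c) t) = t.
  by rewrite -{1}(size_tuple (nseq_tuple N c)) iter_shift_wcat.
rewrite tE H1 H2 !drop_nseq_tuple !winf_nseq ?subn_gt0 // /t.
case: asboolP => h; split=> // h'.
  apply: prec_maxw => E.
  by have := congr1 (@^~ 0) E; have := congr1 (@^~ 1) E; rewrite /maxw /= => ->.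
case: (prec_asym h'); apply: minw_prec => E.
by have := congr1 (@^~ 0) E; have := congr1 (@^~ 1) E; rewrite /minw /= => ->.
Qed.

(** All nonempty suffixes have the same periodic word, so only the one of length 1, at index [N.-1],
    is primitive. *)
Lemma card_prim_suffixes_nseq (N : nat) (b : bool) : 0 < N ->
  #|prim_suffixes N (nseq_tuple N b)| = 1.
Proof.
move=> N0; have ltN : N.-1 < N by lia.
rewrite -(cards1 (Ordinal ltN)); congr #|pred_of_set _|; apply/setP => k.
have ltk := ltn_ord k; rewrite !inE; apply/asboolP/eqP => [prim|-> /=].
  have D : drop k (nseq_tuple N b) = [:: b].
    apply: primitive_winf_inj => //; first exact: primitive1.
      by rewrite size_drop size_tuple subn_gt0.
    by rewrite drop_nseq_tuple winf_nseq ?subn_gt0 // -(@winf_nseq 1).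
  apply: val_inj => /=; have := congr1 size D.
  by rewrite size_drop size_tuple /=; lia.
by rewrite drop_nseq_tuple; have -> : N - N.-1 = 1 by [lia]; apply: primitive1.
Qed.

Lemma card_patterns_of (N : nat) (w : N.-tuple bool) : 2 <= N ->
  #|patterns_of N w| + (drop (N - 2) w == [:: true; false])
    + (drop (N - 2) w == [:: false; true]) = #|prim_suffixes N w|.+1.
Proof. by rewrite card_patterns_of_labels; apply: card_class_labels. Qed.

Lemma card_patterns_of_nseq (N : nat) (b : bool) : 2 <= N ->
  #|patterns_of N (nseq_tuple N b)| = 2.
Proof.
move=> N2; have := card_patterns_of (nseq_tuple N b) N2.
rewrite card_prim_suffixes_nseq ?drop_nseq_tuple; last by lia.
have -> : N - (N - 2) = 2 by lia.
by case: b => /=; lia.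
Qed.

(** Where two prefixes of a common pattern differ, [two_codings] makes the one with the larger
    letter equal to 1^N. *)
Lemma patterns_of_disjoint (N : nat) (w w' : N.-tuple bool) : 2 <= N ->
    w != w' -> w != nseq_tuple N true -> w' != nseq_tuple N true ->
  [disjoint patterns_of N w & patterns_of N w'].
Proof.
case: N w w' => [|[|M]] // w w' _ ne nw nw'.
rewrite -setI_eq0; apply/eqP/setP => p; rewrite inE in_set0; apply/negP.
case/andP=> /patterns_ofP[s [sw sp]] /patterns_ofP[s' [sw' sp']].
have ones (u : M.+2.-tuple bool) (r : word2) :
    starts_with r u -> (forall i, i < M.+2 -> r i = true) -> u = nseq_tuple M.+2 true.
  move=> ru r1; apply: eq_from_tnth => i.
  by rewrite !(tnth_nth false) nth_nseq ltn_ord -ru ?size_tuple // r1.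
have [a nea] : exists a : 'I_M.+2, tnth w a != tnth w' a.
  apply/existsP; apply: contraR ne; rewrite negb_exists => /forallP eqw.
  by apply/eqP/eq_from_tnth => i; apply/eqP; rewrite -[_ == _]negbK.
have sa : s a = tnth w a by rewrite (tnth_nth false) sw ?size_tuple.
have sa' : s' a = tnth w' a by rewrite (tnth_nth false) sw' ?size_tuple.
have [lt|lt] : s a < s' a \/ s' a < s a.
- by move: nea; rewrite sa sa'; case: (tnth w a); case: (tnth w' a) => //; [right|left].
- case/eqP: nw'; apply: (ones _ _ sw'); apply: (two_codings sp sp').
  by exists a.
- case/eqP: nw; apply: (ones _ _ sw); apply: (two_codings sp' sp).
  by exists a.
Qed.

(** The prefix 1^N can be left out because its patterns also arise from 0^N. *)
Lemma allowed_patterns_bigcup (N : nat) : 0 < N ->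
  allowed_patterns N.+1 =
  \bigcup_(w : N.-tuple bool)
     (if w == nseq_tuple N true then set0 else patterns_of N w).
Proof.
move=> N0; apply/setP => p; rewrite inE; apply/asboolP/bigcupP => [[s sp]|[w _]].
  have sz : size (mkseq s N) == N by rewrite size_mkseq.
  have pw : p \in patterns_of N (Tuple sz).
    by apply/patterns_ofP; exists s; split=> //; apply: starts_with_take.
  case: (eqVneq (Tuple sz) (nseq_tuple N true)) => [E|ne].
    exists (nseq_tuple N false) => //; rewrite ifN.
      by apply: (subsetP (patterns_of_nseq_sub N true false)); rewrite -E.
    apply/eqP => /(congr1 (fun u : N.-tuple bool => nth false u 0)).
    by rewrite !nth_nseq N0.
  by exists (Tuple sz); rewrite // ifN.
case: ifP => _; first by rewrite in_set0.
by case/patterns_ofP=> s [_ sp]; exists s.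
Qed.

(** * Counting *)

Lemma card_tuple_drop (N k m : nat) (Q : pred (seq bool)) : N = k + m ->
  #|[set w : N.-tuple bool | Q (drop k w)]| =
  2 ^ k * #|[set v : m.-tuple bool | Q v]|.
Proof.
move=> ->.
pose glue (uv : k.-tuple bool * m.-tuple bool) := cat_tuple uv.1 uv.2.
have gi : injective glue.
  move=> [u v] [u' v'] /(congr1 val) /= /eqP; rewrite eqseq_cat ?size_tuple //.
  by case/andP=> /eqP/val_inj -> /eqP/val_inj ->.
have -> : [set w : (k + m).-tuple bool | Q (drop k w)] =
          glue @: setX [set: k.-tuple bool] [set v : m.-tuple bool | Q v].
  apply/setP => w; rewrite inE; apply/idP/imsetP => [Qw|[[u v]]]; last first.
    by rewrite !inE /= => Qv ->; rewrite drop_size_cat ?size_tuple.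
  have szt : size (take k w) == k by rewrite size_takel // size_tuple leq_addr.
  have szd : size (drop k w) == m by rewrite size_drop size_tuple addKn.
  exists (Tuple szt, Tuple szd); rewrite ?inE //.
  by apply: val_inj; rewrite /= cat_take_drop.
by rewrite card_imset // cardsX cardsT card_tuple card_bool.
Qed.

Lemma sum_prim_suffixes (N : nat) :
  \sum_(w : N.-tuple bool) #|prim_suffixes N w| = a_ N.+1.
Proof.
pose Q (v : seq bool) := `[< primitive_word v >].
have -> : \sum_(w : N.-tuple bool) #|prim_suffixes N w| =
          \sum_(w : N.-tuple bool) \sum_(k < N) Q (drop k w).
  apply: eq_bigr => w _; rewrite -sum1_card big_mkcond /=.
  by apply: eq_bigr => k _; rewrite inE /Q; case: asboolP.
(* The reindexing replaces the start of a suffix by its length; the letters before the suffix are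
   free and give the power of 2. *)
rewrite exchange_big /a_ big_add1 big_mkord (reindex_inj rev_ord_inj) /=.
apply: eq_bigr => k _; have ltk := ltn_ord k.
have -> : N.+1 - k.+1 - 1 = N - k.+1 by lia.
rewrite mulnC -(@card_tuple_drop N _ k.+1 Q); last by lia.
by rewrite -sum1dep_card [RHS]big_mkcond /=; apply: eq_bigr => w _; case: (Q _).
Qed.

Lemma sum_ends_with (N : nat) (a b : bool) : 2 <= N ->
  \sum_(w : N.-tuple bool) (drop (N - 2) w == [:: a; b]) = 2 ^ (N - 2).
Proof.
move=> N2; transitivity #|[set w : N.-tuple bool | drop (N - 2) w == [:: a; b]]|.
  by rewrite -sum1dep_card [RHS]big_mkcond /=; apply: eq_bigr => w _; case: eqP.
rewrite (@card_tuple_drop N _ 2 (fun v => v == [:: a; b])); last by lia.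
have -> : [set v : 2.-tuple bool | val v == [:: a; b]] = [set [tuple a; b]].
  by apply/setP => v; rewrite !inE -val_eqE.
by rewrite cards1 muln1.
Qed.

(* For 3 <= n the truncated subtractions agree with integer subtraction. *)
Theorem theorem3p9 (n : nat) (hn : 3 <= n) :
  #|allowed_patterns n| = a_ n + 2 ^ (n - 2) - 2.
Proof.
case: n hn => // N N2; rewrite ltnS in N2.
have N0 : 0 < N by lia.
(* The labels lost to the endings 10 and 01 are added on the left, which avoids truncated
   subtraction. *)
have total : \sum_(w : N.-tuple bool) #|patterns_of N w| + 2 ^ (N - 2) + 2 ^ (N - 2)
    = a_ N.+1 + 2 ^ N.
  rewrite -{1}(@sum_ends_with N true false N2) -(@sum_ends_with N false true N2).
  rewrite -!big_split /= (eq_bigr (fun w : N.-tuple bool => #|prim_suffixes N w| + 1)).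
    by rewrite big_split /= sum_prim_suffixes sum1_card card_tuple card_bool.
  by move=> w _; rewrite card_patterns_of // addn1.
have pow : 2 ^ N = 2 ^ (N - 2) + 2 ^ (N - 2) + 2 ^ (N.+1 - 2).
  have -> : N.+1 - 2 = (N - 2).+1 by lia.
  by rewrite -[in LHS](subnK N2) expnD (expnS 2 (N - 2)) -[2 ^ 2]/4; lia.
(* The 2 is the number of patterns of the omitted prefix 1^N. *)
suff : #|allowed_patterns N.+1| + 2 = \sum_(w : N.-tuple bool) #|patterns_of N w|.
  by lia.
rewrite allowed_patterns_bigcup // -sum1_card partition_disjoint_bigcup /=; last first.
  move=> w w' ne; case: eqP => [_|/eqP nw]; first by rewrite -setI_eq0 set0I.
  case: eqP => [_|/eqP nw']; first by rewrite -setI_eq0 setI0.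
  exact: patterns_of_disjoint.
rewrite [RHS](bigD1 (nseq_tuple N true)) //= card_patterns_of_nseq // addnC.
congr (_ + _); rewrite (bigD1 (nseq_tuple N true)) //= eqxx big_set0 add0n.
by apply: eq_bigr => w /negPf ->; rewrite sum1_card.
Qed.
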